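(* Let $G\in\mathcal{Q}$. Then $c(G)=2^{|V(G)|-3}$.
   Context: The family $\mathcal{Q}$ of graphs is defined recursively: the complete graph $K_3$ belongs to $\mathcal{Q}$; and whenever $G_1,G_2\in\mathcal{Q}$, $u_1,v_1$ are two distinct vertices of $G_1$ and $e=u_2v_2$ is an edge of $G_2$, the graph obtained from disjoint copies of $G_1$ and $G_2-e$ by identifying $u_1$ with $u_2$ and $v_1$ with $v_2$ belongs to $\mathcal{Q}$. (All graphs in $\mathcal{Q}$ are rigid.) A complex realisation of a graph $G=(V,E)$ is a map $p:V\to\mathbb{C}^2$; for $P=(x,y)$ put $d(P)=x^2+y^2$. Realisations $(G,p),(G,q)$ are equivalent if $d(p(u)-p(v))=d(q(u)-q(v))$ for all $uv\in E$, and congruent if this holds for all $u,v\in V$. A realisation is generic if the set of all coordinates of the points $p(v)$ is algebraically independent over $\mathbb{Q}$. For a rigid graph $G$ (one whose rigidity matrix at a generic real realisation has rank $2|V|-3$), $c(G)$ is the number of congruence classes in the set of complex realisations equivalent to a given generic complex realisation (finite and independent of the choice). *)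

(* Defs.v *)
From HB Require Import structures.
From mathcomp Require Import all_boot all_order all_algebra.
From mathcomp Require Import reals.
From mathcomp Require Import complex.
From mathcomp Require Import mpoly.
Import GRing.Theory Num.Theory.
Set Implicit Arguments. Unset Strict Implicit. Unset Printing Implicit Defensive.
Local Open Scope ring_scope.

(* The graph obtained from disjoint copies of G1 and G2 - u2v2 by identifying
   u1 with u2 and v1 with v2, described up to isomorphism via the two
   embeddings f1, f2 of the copies into the vertex set 'I_m of the result. *)
Definition is_glue (n1 : nat) (E1 : rel 'I_n1) (n2 : nat) (E2 : rel 'I_n2)
  (m : nat) (E : rel 'I_m) (u1 v1 : 'I_n1) (u2 v2 : 'I_n2)
  (f1 : 'I_n1 -> 'I_m) (f2 : 'I_n2 -> 'I_m) : Prop :=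
  injective f1 /\ injective f2 /\ f1 u1 = f2 u2 /\ f1 v1 = f2 v2 /\
      (forall a b, f1 a = f2 b -> (a = u1 /\ b = u2) \/ (a = v1 /\ b = v2)) /\
      (forall x, (exists a, x = f1 a) \/ (exists b, x = f2 b)) /\
      (forall x y, E x y <->
         (exists a b, [/\ E1 a b, x = f1 a & y = f1 b]) \/
         (exists a b, [/\ E2 a b,
                          ~~ (((a == u2) && (b == v2)) || ((a == v2) && (b == u2))),
                          x = f2 a & y = f2 b])).

Inductive inQ : forall n : nat, rel 'I_n -> Prop :=
| inQ_K3 : forall E : rel 'I_3, (forall x y, E x y = (x != y)) -> inQ E
| inQ_glue : forall (n1 : nat) (E1 : rel 'I_n1) (n2 : nat) (E2 : rel 'I_n2)
    (m : nat) (E : rel 'I_m) (u1 v1 : 'I_n1) (u2 v2 : 'I_n2)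
    (f1 : 'I_n1 -> 'I_m) (f2 : 'I_n2 -> 'I_m),
    inQ E1 -> inQ E2 -> u1 != v1 -> E2 u2 v2 ->
    is_glue E1 E2 E u1 v1 u2 v2 f1 f2 -> inQ E.

Definition sqd (C : comRingType) (n : nat) (p : 'M[C]_(n, 2)) (u v : 'I_n) : C :=
  \sum_(j < 2) (p u j - p v j) ^+ 2.

Definition equivalent (C : comRingType) (n : nat) (E : rel 'I_n)
  (p q : 'M[C]_(n, 2)) : Prop :=
  forall u v, E u v -> sqd p u v = sqd q u v.

Definition congruent (C : comRingType) (n : nat) (p q : 'M[C]_(n, 2)) : Prop :=
  forall u v, sqd p u v = sqd q u v.

Definition generic (R : realType) (n : nat) (p : 'M[R[i]]_(n, 2)) : Prop :=
  forall P : {mpoly rat[n * 2]}, P != 0 ->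
    (map_mpoly (ratr : rat -> R[i]) P).@[fun k => mxvec p 0 k] != 0.

(* Main.v *)
(* In the isotropic coordinates (x + iy, x - iy) the form x^2 + y^2 becomes a
   product, and the isometries fixing the origin are (z, w) -> (tz, w/t) and the
   swap; so a realisation can be normalised to put two vertices at distance
   d <> 0 at (0, 0) and (1, d), and this determines it up to the reflection
   (z, w) -> (w/d, dz). A graph in the family has at most 2n - 3 edges, and for a
   generic realisation the edge lengths have transcendence degree 2n - 3.
   Conversely, if prescribed edge lengths have transcendence degree 2n - 3, then
   in every realisation of them all distances are transcendental and no three
   vertices are collinear, because a normalisation violating this would leave too
   few free coordinates. By induction such lengths have exactly 2^(n-3)
   realisations up to congruence: when glueing, a realisation of the first graph
   imposes a length on the deleted edge of the second, this length is algebraic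
   over the lengths of the first graph and transcendental, so the lengths of the
   second graph again have full transcendence degree, and each pair of
   realisations can be glued in two incongruent ways, differing by a reflection
   in the line of the two common vertices. *)
Require Import Defs.
From HB Require Import structures.
From mathcomp Require Import all_boot all_order all_algebra.
From mathcomp Require Import reals.
From mathcomp Require Import complex.
From mathcomp Require Import mpoly.
From mathcomp Require Import boolp polyXY ring zify.
Import GRing.Theory Num.Theory.
Local Open Scope ring_scope.

Set Implicit Arguments.
Unset Strict Implicit.
Unset Printing Implicit Defensive.

(** * Algebraically closed subfields *)

Record acfield {C : fieldType} (K : C -> Prop) : Prop := AcField {
  ac1 : K 1;
  acB : forall x y, K x -> K y -> K (x - y);
  ac_div : forall x y, K x -> K y -> K (x / y);
  ac_root : forall (p : {poly C}) x,
    p != 0 -> (forall i, K p`_i) -> root p x -> K x }.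

Definition algebraic_over {C : fieldType} (S : C -> Prop) (x : C) : Prop :=
  exists p : {poly C}, [/\ p != 0, forall i, S p`_i & root p x].

Section AlgebraicOverSubring.
Variables (C : fieldType) (S : C -> Prop).
Hypotheses (S1 : S 1) (SB : forall x y, S x -> S y -> S (x - y)).
Hypothesis (SM : forall x y, S x -> S y -> S (x * y)).

Let S0 : S 0. Proof. by rewrite -(subrr 1); exact: SB. Qed.

(** The fraction field of [S] inside [C], made boolean by classical reflection so that it carries a
    field structure and the library theory of algebraic elements applies. *)
Definition fracb : pred C :=
  fun x => `[< exists a b, [/\ S a, S b, b != 0 & x = a / b] >].

Lemma fracb_id x : S x -> fracb x.
Proof. by move=> Sx; apply/asboolP; exists x, 1; rewrite divr1 oner_eq0. Qed.

Lemma fracb_divring_closed : divring_closed fracb.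
Proof.
split; first exact: fracb_id.
- move=> x y /asboolP[a [b [Sa Sb b0 ->]]] /asboolP[c [d [Sc Sd d0 ->]]].
  apply/asboolP; exists (a * d - c * b), (b * d).
  by rewrite mulf_neq0 //; split=> //; [apply: SB; exact: SM|exact: SM|field; rewrite d0 b0].
- move=> x y /asboolP[a [b [Sa Sb b0 ->]]] /asboolP[c [d [Sc Sd d0 ->]]].
  have [->|c0] := eqVneq c 0.
    by rewrite mul0r invr0 mulr0; apply/fracb_id.
  apply/asboolP; exists (a * d), (b * c).
  by rewrite mulf_neq0 //; split=> //; [exact: SM|exact: SM|field; rewrite ?b0 ?c0 ?d0].
Qed.

HB.instance Definition _ := GRing.isDivringClosed.Build C fracb fracb_divring_closed.
Record fracT := FracT { frac_val :> C; _ : fracb frac_val }.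
HB.instance Definition _ := [isSub of fracT for frac_val].
HB.instance Definition _ := [Choice of fracT by <:].
HB.instance Definition _ := [SubChoice_isSubIntegralDomain of fracT by <:].
HB.instance Definition _ := [SubIntegralDomain_isSubField of fracT by <:].

Lemma common_denominator (s : seq C) : all fracb s ->
  exists b, [/\ S b, b != 0 & forall x, x \in s -> S (b * x)].
Proof.
elim: s => [_|x s IHs /= /andP[/asboolP[a [c [Sa Sc c0 ->]]] /IHs[b [Sb b0 bs]]]].
  by exists 1; rewrite oner_eq0.
exists (b * c); rewrite mulf_neq0 //; split=> //; first exact: SM.
move=> y; rewrite inE => /orP[/eqP->|/bs Sby].
  have -> : b * c * (a / c) = b * a by field.
  exact: SM.
by rewrite mulrAC; exact: SM.
Qed.

(** From right to left, a common denominator of the coefficients brings them back into [S]. *)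
Lemma algebraic_overE x :
  algebraic_over S x <-> algebraicOver (val : fracT -> C) x.
Proof.
split=> [[p [p0 Sp px]]|[p p0 px]].
  pose q : {poly fracT} := \poly_(i < size p) FracT (fracb_id (Sp i)).
  have qE : map_poly val q = p.
    apply/polyP => i; rewrite coef_map coef_poly; case: ltnP => //= pi.
    by rewrite nth_default.
  by exists q; rewrite ?qE // -(map_poly_eq0 (val : fracT -> C)) qE.
have : all fracb (map_poly val p : {poly C}).
  apply/(all_nthP 0) => i _; rewrite coef_map; exact: valP.
move=> /common_denominator[b [Sb b0 bP]].
exists (b *: map_poly val p).
split; first by rewrite scaler_eq0 negb_or b0 map_poly_eq0.
  move=> i; rewrite coefZ.
  have [ip|ip] := ltnP i (size (map_poly val p : {poly C})); first exact/bP/mem_nth.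
  by rewrite (nth_default _ ip) mulr0.
by rewrite rootZ.
Qed.

Lemma acfield_algebraic_over : acfield (algebraic_over S).
Proof.
split.
- by apply/algebraic_overE; exact: algebraic1.
- move=> x y /algebraic_overE ? /algebraic_overE ?; apply/algebraic_overE.
  exact: algebraic_sub.
- move=> x y /algebraic_overE ? /algebraic_overE ?; apply/algebraic_overE.
  exact: algebraic_div.
- move=> p x p0 Kp px; apply/algebraic_overE/integral_algebraic.
  apply: (@integral_root _ _ _ p) => // c /(nthP 0)[i _ <-].
  by apply/integral_algebraic/algebraic_overE.
Qed.

Lemma algebraic_over_id x : S x -> algebraic_over S x.
Proof.
move=> Sx; exists ('X - x%:P); split=> [|i|].
- by rewrite polyXsubC_eq0.
- by rewrite coefB coefX coefC; apply: SB; [case: (i == 1)%N|case: (i == 0)%N].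
- by rewrite root_XsubC.
Qed.

End AlgebraicOverSubring.

Section AcfieldTheory.
Variables (C : fieldType) (K : C -> Prop).
Hypothesis acK : acfield K.

Lemma ac0 : K 0.
Proof. by rewrite -(subrr 1); apply: (acB acK); exact: ac1 acK. Qed.

Lemma acN x : K x -> K (- x).
Proof. by rewrite -sub0r => ?; apply: (acB acK) => //; exact: ac0. Qed.

Lemma acD x y : K x -> K y -> K (x + y).
Proof. by rewrite -{2}(opprK y) => ? ?; apply: (acB acK) => //; exact: acN. Qed.

Lemma acV x : K x -> K x^-1.
Proof. by rewrite -div1r => ?; apply: (ac_div acK) => //; exact: ac1 acK. Qed.

Lemma acM x y : K x -> K y -> K (x * y).
Proof. by rewrite -{2}(invrK y) => ? ?; apply: (ac_div acK) => //; exact: acV. Qed.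

Lemma ac_nat n : K n%:R.
Proof. by elim: n => [|n IHn]; [exact: ac0|rewrite mulrS; apply: acD (ac1 acK) IHn]. Qed.

Lemma acX x n : K x -> K (x ^+ n).
Proof.
by move=> Kx; elim: n => [|n IHn]; [exact: ac1 acK|rewrite exprS; exact: acM].
Qed.

Lemma ac_sum (I : Type) (r : seq I) (F : I -> C) :
  (forall i, K (F i)) -> K (\sum_(i <- r) F i).
Proof. by move=> KF; elim/big_rec: _ => [|i x _ Kx]; [exact: ac0|exact: acD]. Qed.

Lemma ac_horner (p : {poly C}) x : (forall i, K p`_i) -> K x -> K p.[x].
Proof.
by move=> Kp Kx; rewrite horner_coef; apply: ac_sum => i; apply/acM/acX.
Qed.

Lemma ac_quadratic a b c x :
  K a -> K b -> K c -> a != 0 -> a * x ^+ 2 + b * x + c = 0 -> K x.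
Proof.
move=> Ka Kb Kc a0 e.
have pE : (Poly [:: c; b; a]).[x] = 0 by rewrite horner_Poly /= -[RHS]e; ring.
apply: (ac_root acK (p := Poly [:: c; b; a])); last exact/rootP.
  apply/eqP => /(congr1 (fun p : {poly C} => p`_2)).
  by rewrite coef_Poly coef0 => /eqP; rewrite (negPf a0).
by move=> [|[|[|i]]]; rewrite coef_Poly //= nth_nil; exact: ac0.
Qed.

End AcfieldTheory.

(** The algebraic closure in [C] of the field generated by [s], as an intersection of relatively
    algebraically closed subfields. *)
Definition acl {C : fieldType} (s : seq C) (x : C) : Prop :=
  forall K : C -> Prop, acfield K -> (forall y, y \in s -> K y) -> K x.

Section Closure.
Variable C : fieldType.
Implicit Types (s t : seq C) (x y : C).

Lemma acfield_acl s : acfield (acl s).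
Proof.
split=> [K acK _|x y Kx Ky K acK sK|x y Kx Ky K acK sK|p x p0 Kp px K acK sK].
- exact: ac1 acK.
- by apply: (acB acK); [apply: Kx|apply: Ky].
- by apply: (ac_div acK); [apply: Kx|apply: Ky].
- by apply: (ac_root acK p0 _ px) => i; exact: Kp.
Qed.

Lemma mem_acl s x : x \in s -> acl s x.
Proof. by move=> xs K _; exact. Qed.

Lemma acl_trans s t x : (forall y, y \in s -> acl t y) -> acl s x -> acl t x.
Proof. by move=> st sx; apply: sx => //; exact: acfield_acl. Qed.

Lemma acl_sub s t x : {subset s <= t} -> acl s x -> acl t x.
Proof. by move=> st; apply: acl_trans => y /st; exact: mem_acl. Qed.

(* The polynomials over [acl s] evaluated at [y] form a subring [S]; a relation
   for [x] over [S] is a bivariate relation, which can be read the other way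
   as a polynomial relation for [y] over [acl (x :: s)]. *)
Lemma acl_exchange s x y : acl (y :: s) x -> ~ acl s x -> acl (x :: s) y.
Proof.
move=> yx sx; have acK := acfield_acl s; have acKx := acfield_acl (x :: s).
pose S c := exists2 f : {poly C}, (forall i, acl s f`_i) & c = f.[y].
have S1 : S 1.
  exists 1; last by rewrite hornerC.
  by move=> i; rewrite coef1; exact: (ac_nat acK).
have SB a b : S a -> S b -> S (a - b).
  move=> [f Kf ->] [g Kg ->]; exists (f - g); last by rewrite hornerD hornerN.
  by move=> i; rewrite coefB; exact: (acB acK).
have SM a b : S a -> S b -> S (a * b).
  move=> [f Kf ->] [g Kg ->]; exists (f * g); last by rewrite hornerM.
  by move=> i; rewrite coefM; apply: (ac_sum acK) => j; exact: (acM acK).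
have [p [p0 Sp px]] : algebraic_over S x.
  apply: yx; first exact: acfield_algebraic_over.
  move=> a; rewrite inE => /orP[/eqP->|sa]; apply: algebraic_over_id => //.
    by exists 'X => [i|]; rewrite ?hornerX // coefX; exact: (ac_nat acK).
  exists a%:P; last by rewrite hornerC.
  move=> i; rewrite coefC.
  by case: (i == 0)%N; [exact: mem_acl|exact: (ac0 acK)].
have /choice[f fP] i : exists g : {poly C}, (forall j, acl s g`_j) /\ p`_i = g.[y].
  by case: (Sp i) => g; exists g.
pose F := \poly_(i < size p) f i.
have FE : map_poly (horner_eval y) F = p.
  apply/polyP => i; rewrite coef_map /= coef_poly /horner_eval.
  case: ltnP => ip; first by rewrite (fP i).2.
  by rewrite horner0 nth_default.
have KF i j : acl s F`_i`_j.
  rewrite coef_poly; case: ifP => _; first exact: (fP i).1.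
  by rewrite coef0; exact: (ac0 acK).
have F0 : swapXY F != 0.
  by rewrite swapXY_eq0; apply: contra_neq p0 => F0; rewrite -FE F0 rmorph0.
pose q := map_poly (horner_eval x) (swapXY F).
apply: (ac_root acKx (p := q)).
(* Were [q] zero, every coefficient of the swapped polynomial would vanish at [x]; a nonzero one
   would make [x] algebraic over [acl s]. *)
- have [j Fj] : exists j, (swapXY F)`_j != 0.
    by exists (size (swapXY F)).-1; rewrite -lead_coefE lead_coef_eq0.
  apply/eqP => q0; apply: sx; apply: (ac_root acK Fj).
    by move=> i; rewrite coef_swapXY.
  by apply/rootP; move/polyP/(_ j): q0; rewrite coef_map coef0.
- move=> j; rewrite coef_map /= /horner_eval; apply: (ac_horner acKx).
    move=> i; rewrite coef_swapXY; apply: acl_sub (KF _ _) => z.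
    by rewrite inE orbC => ->.
  by apply: mem_acl; rewrite mem_head.
- apply/rootP; rewrite -[RHS](rootP px) -FE.
  have hE (G : {poly {poly C}}) a b : (map_poly (horner_eval a) G).[b] = G.[b%:P].[a].
    by rewrite -{1}(hornerC b a) -[_.[a]]/(horner_eval a _) horner_map.
  by rewrite !hE horner2_swapXY.
Qed.

End Closure.

(** * Transcendence degree *)

Section Rank.
Variable C : fieldType.
Implicit Types (s t : seq C) (x y : C).

(* Transcendence degree of [s] over [acl t]. *)
Fixpoint rank_over t s : nat :=
  if s is x :: s' then (~~ `[< acl (s' ++ t) x >] + rank_over t s')%N else 0.

Lemma eq_acl s t : s =i t -> acl s = acl t.
Proof.
by move=> st; apply/funext => x; apply/propext; split; apply: acl_sub => y; rewrite st.
Qed.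

Lemma rank_over_cat t s s' :
  rank_over t (s ++ s') = (rank_over (s' ++ t) s + rank_over t s')%N.
Proof. by elim: s => //= x s ->; rewrite catA addnA. Qed.

Lemma acl_absorb t x y : acl t x -> acl (x :: t) y -> acl t y.
Proof. by move=> tx; apply: acl_trans => z; rewrite inE => /orP[/eqP->//|/mem_acl]. Qed.

Lemma eq_acl_rank t t' s : t =i t' -> rank_over t s = rank_over t' s.
Proof.
move=> tt'; elim: s => //= x s ->; rewrite (@eq_acl (s ++ t) (s ++ t')) // => z.
by rewrite !mem_cat tt'.
Qed.

Lemma rank_over_size t s : (rank_over t s <= size s)%N.
Proof. by elim: s => //= x s; case: `[< _ >] => /=; lia. Qed.

Lemma rank_over_anti t t' s : (forall y, y \in t -> acl t' y) ->
  (rank_over t' s <= rank_over t s)%N.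
Proof.
move=> tt'; elim: s => //= x s; suff : `[< acl (s ++ t) x >] ==> `[< acl (s ++ t') x >].
  by do 2!case: `[< _ >] => //=; lia.
apply/implyP => /asboolP sx; apply/asboolP; apply: acl_trans sx => y.
rewrite mem_cat => /orP[sy|/tt']; first by apply: mem_acl; rewrite mem_cat sy.
by apply: acl_sub => z; rewrite mem_cat orbC => ->.
Qed.

Lemma rank_over0 t s : (forall y, y \in s -> acl t y) -> rank_over t s = 0%N.
Proof.
elim: s => //= x s IHs st; rewrite IHs; last by move=> y ys; apply: st; rewrite inE ys orbT.
have /asboolP -> // : acl (s ++ t) x.
by apply: acl_sub (st x (mem_head _ _)) => z; rewrite mem_cat orbC => ->.
Qed.

(** The definition tests the head over everything that follows it; here it is tested first, over [t]
    alone. Independence of the order rests on this. *)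
Lemma rank_over_cons t x s :
  rank_over t (x :: s) = (~~ `[< acl t x >] + rank_over (x :: t) s)%N.
Proof.
elim: s => [//|y s IHs].
have -> : rank_over t (x :: y :: s) =
  (~~ `[< acl (y :: s ++ t) x >] + (~~ `[< acl (s ++ t) y >] + rank_over t s))%N by [].
have -> : rank_over (x :: t) (y :: s) =
  (~~ `[< acl (x :: s ++ t) y >] + rank_over (x :: t) s)%N.
  rewrite [LHS]/= (@eq_acl (s ++ x :: t) (x :: s ++ t)) // => z.
  by rewrite !(inE, mem_cat) orbCA.
rewrite [RHS]addnCA -IHs /=.
have sub a : forall z, z \in s ++ t -> z \in a :: s ++ t by move=> z; rewrite inE orbC => ->.
(* [lia] settles the cases where both counts agree; the others contradict exchange, monotonicity of
   the closure, or absorption of an algebraic element. *)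
case: (asboolP (acl (s ++ t) x)) => [xK|xK]; case: (asboolP (acl (s ++ t) y)) => [yK|yK];
  case: (asboolP (acl (y :: s ++ t) x)) => [yx|yx];
  case: (asboolP (acl (x :: s ++ t) y)) => [xy|xy] //=; try lia.
all: exfalso.
all: try by [case: xy; apply: acl_exchange yx _|case: yx; apply: acl_exchange xy _].
all: try by [case: xy; apply: acl_sub yK; exact: sub|case: yx; apply: acl_sub xK; exact: sub].
all: by [case: yK; apply: acl_absorb xK xy|case: xK; apply: acl_absorb yK yx].
Qed.

Lemma rank_overC t s s' : rank_over t (s ++ s') = rank_over t (s' ++ s).
Proof.
elim: s t => [|x s IHs] t; first by rewrite cats0.
rewrite cat_cons rank_over_cons IHs !rank_over_cat rank_over_cons.
rewrite (@eq_acl_rank (s ++ x :: t) ((x :: s) ++ t)); first by lia.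
by move=> z; rewrite !(inE, mem_cat) orbCA.
Qed.

Definition rank := rank_over [::].

Lemma rank_cat s t : rank (s ++ t) = (rank_over t s + rank t)%N.
Proof. by rewrite /rank rank_over_cat cats0. Qed.

Lemma rank_size s : (rank s <= size s)%N.
Proof. exact: rank_over_size. Qed.

(** The rank of [s ++ t] is [rank t], since [s] adds nothing; computed in the other order it is at
    least [rank s]. *)
Lemma rank_le s t : (forall x, x \in s -> acl t x) -> (rank s <= rank t)%N.
Proof.
move=> st; have := rank_overC [::] s t.
by rewrite -/rank !rank_cat (rank_over0 st) add0n => ->; exact: leq_addl.
Qed.

Lemma rank1 x : rank [:: x] = ~~ `[< acl [::] x >].
Proof. by rewrite /rank /= addn0. Qed.

Lemma rank_free (I : eqType) (r : seq I) (v : I -> C) : uniq r ->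
  (forall i, i \in r -> ~ acl [seq v j | j <- rem i r] (v i)) ->
  rank [seq v i | i <- r] = size r.
Proof.
rewrite /rank; elim: r => //= i r IHr /andP[ir ur] vr; rewrite cats0 IHr //.
  have /asboolPn -> // : ~ acl [seq v j | j <- r] (v i).
  by have := vr i (mem_head _ _); rewrite eqxx.
move=> j jr; have := vr j; rewrite inE jr orbT => /(_ isT) h sj; apply: h.
have /negPf -> : i != j by apply: contraNneq ir => ->.
by apply: acl_sub sj => z; rewrite inE orbC => ->.
Qed.
End Rank.

(** * Isotropic coordinates *)

Definition dist {C : fieldType} {T : Type} (q : T -> C * C) (x y : T) : C :=
  ((q x).1 - (q y).1) * ((q x).2 - (q y).2).

Section Isotropic.
Variables (C : fieldType) (T : Type).
Implicit Types (p q : T -> C * C) (u v x y a b : T) (d : C).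

Definition based q u v d := q u = (0, 0) /\ q v = (1, d).

Definition normalise q u v : T -> C * C := fun x =>
  (((q x).1 - (q u).1) / ((q v).1 - (q u).1),
   ((q x).2 - (q u).2) * ((q v).1 - (q u).1)).

(* For [q] based at [u, v], the mirror image of [q] in the line [uv]. *)
Definition mirror d q : T -> C * C := fun x => ((q x).2 / d, (q x).1 * d).

Lemma distC q x y : dist q x y = dist q y x.
Proof. by rewrite /dist; ring. Qed.

Lemma distxx q x : dist q x x = 0.
Proof. by rewrite /dist subrr mul0r. Qed.

Lemma dist_normalise q u v x y : dist q u v != 0 ->
  dist (normalise q u v) x y = dist q x y.
Proof.
rewrite /dist /= mulf_eq0 negb_or subr_eq0 eq_sym -subr_eq0 => /andP[uv _].
by field.
Qed.

Lemma normalise_based q u v : dist q u v != 0 ->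
  based (normalise q u v) u v (dist q u v).
Proof.
rewrite /dist mulf_eq0 negb_or subr_eq0 eq_sym -subr_eq0 => /andP[uv _].
rewrite /based /normalise !subrr !mul0r divff //; split=> //.
by congr (_, _); ring.
Qed.

Lemma dist_mirror d q x y : d != 0 -> dist (mirror d q) x y = dist q x y.
Proof. by rewrite /dist /= => d0; field. Qed.

Lemma mirror_based d q u v : d != 0 -> based q u v d -> based (mirror d q) u v d.
Proof.
by rewrite /based /mirror => d0 [-> ->] /=; rewrite !mul0r mul1r divff.
Qed.

Lemma mirrorK d q : d != 0 -> mirror d (mirror d q) =1 q.
Proof.
by move=> d0 x; rewrite /mirror /= mulfK // divfK // -surjective_pairing.
Qed.

(** A normal form that allows distance zero: if only the first coordinates of [u] and [v] agree, the
    coordinates are exchanged; if both agree, a translation is enough. In every case the new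
    coordinates of [u] and [v] are algebraic over their distance. *)
Lemma degenerate_based q u v : exists2 q', dist q' =2 dist q &
  [/\ q' u = (0, 0), (q' v).1 = 0 \/ (q' v).1 = 1 &
      (q' v).2 = 0 \/ (q' v).2 = dist q u v].
Proof.
have [e|e] := eqVneq (q v).1 (q u).1; last first.
  exists (fun x => (((q x).1 - (q u).1) / ((q v).1 - (q u).1),
    ((q x).2 - (q u).2) * ((q v).1 - (q u).1))).
    by move=> x y; rewrite /dist /=; field; rewrite subr_eq0.
  rewrite /= !subrr !mul0r divff ?subr_eq0 //.
  by split; [|right|right; rewrite /dist; ring].
have [f|f] := eqVneq (q v).2 (q u).2.
  exists (fun x => ((q x).1 - (q u).1, (q x).2 - (q u).2)).
    by move=> x y; rewrite /dist /=; ring.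
  by rewrite /= !subrr e f !subrr; split; [|left|left].
exists (fun x => (((q x).2 - (q u).2) / ((q v).2 - (q u).2),
    ((q x).1 - (q u).1) * ((q v).2 - (q u).2))).
  by move=> x y; rewrite /dist /=; field; rewrite subr_eq0.
rewrite /= !subrr !mul0r divff ?subr_eq0 //.
by split; [|right|left; rewrite e subrr mul0r].
Qed.

(** For [q x] = (z, w), the difference of the two distances is linear, so w = b - dz with b in [K];
    the value of zw then gives a quadratic equation for z with leading coefficient [d]. *)
Lemma based_acl (K : C -> Prop) q u v d x : acfield K -> based q u v d -> d != 0 ->
  K d -> K (dist q x u) -> K (dist q x v) -> K (q x).1 /\ K (q x).2.
Proof.
move=> acK [qu qv] d0 Kd; rewrite /dist qu qv /=; set z := (q x).1; set w := (q x).2.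
set a := (z - 0) * (w - 0); set c := (z - 1) * (w - d) => Ka Kc.
have Kb : K (c - a - d).
  by apply: (acB acK) => //; exact: (acB acK).
have Kz : K z.
  apply: (ac_quadratic acK Kd Kb Ka d0).
  by rewrite /a /c; ring.
split=> //; have -> : w = - (c - a - d) - d * z by rewrite /a /c; ring.
by apply: (acB acK); [exact: (acN acK)|exact: (acM acK)].
Qed.

(** With [p x] = (z, w), the distances to [u] and [v] give a quadratic equation for the first
    coordinate of [q x], with roots z and w/d. *)
Lemma based_twin p q u v d x : based p u v d -> based q u v d -> d != 0 ->
  dist p x u = dist q x u -> dist p x v = dist q x v ->
  q x = p x \/ q x = mirror d p x.
Proof.
move=> [pu pv] [qu qv] d0; rewrite /dist /mirror pu pv qu qv /=.
case: (p x) (q x) => z w [z' w'] /= e1 e2.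
have e3 : w' = z * d + w - z' * d.
  have : (z - 0) * (w - 0) - (z - 1) * (w - d) = (z' - 0) * (w' - 0) - (z' - 1) * (w' - d).
    by rewrite e1 e2.
  move/eqP; rewrite -subr_eq0 => /eqP e.
  by apply/eqP; rewrite -subr_eq0; apply/eqP; rewrite -[RHS]oppr0 -e; ring.
have : (z' - z) * (z' * d - w) = 0.
  move/eqP: e1; rewrite -subr_eq0 => /eqP e1; rewrite -[RHS]e1 e3; ring.
move/eqP; rewrite mulf_eq0 !subr_eq0 => /orP[/eqP zz|/eqP zw]; [left|right].
  by rewrite e3 zz; congr (_, _); ring.
by rewrite e3 -zw mulfK //; congr (_, _); ring.
Qed.

(** The points with w = zd form the line through (0, 0) and (1, d), which the mirror fixes
    pointwise. Reflecting one of two points changes their distance unless one of them lies on this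
    line. *)
Lemma based_cross d z w z' w' : d != 0 ->
  (z - z') * (w - w') = (z - w' / d) * (w - z' * d) -> w = z * d \/ w' = z' * d.
Proof.
move=> d0 e; have : (w - z * d) * (w' - z' * d) = 0.
  have -> : (w - z * d) * (w' - z' * d) =
    d * ((z - z') * (w - w') - (z - w' / d) * (w - z' * d)) by field.
  by rewrite e subrr mulr0.
by move/eqP; rewrite mulf_eq0 !subr_eq0 => /orP[/eqP|/eqP]; [left|right].
Qed.

(** If one vertex is kept and another reflected, their unchanged distance puts one of them on the
    axis, where both alternatives coincide. *)
Lemma based_congruent p q u v d : based p u v d -> based q u v d -> d != 0 ->
  dist p =2 dist q -> q =1 p \/ q =1 mirror d p.
Proof.
move=> bp bq d0 pq; have pqx x := based_twin bp bq d0 (pq x u) (pq x v).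
have [|/existsNP[b qb]] := pselect (forall x, q x = p x); [by left|right=> a].
have {}qb' : q b = mirror d p b by case: (pqx b).
have [qa|//] := pqx a.
have := pq a b; rewrite /dist qa qb' /mirror /= => /based_cross.
move=> /(_ d0)[e|e]; first by rewrite /mirror e mulfK // -e; case: (p a).
by case: qb; rewrite qb' /mirror e mulfK // -e; case: (p b).
Qed.

End Isotropic.

(** * Dimension counts for realisations of independent lengths *)

Section RankOfDistances.
Variables (C : fieldType) (T : finType) (q : T -> C * C) (s : seq C).
Hypothesis sD : forall a, a \in s -> exists x y, a = dist q x y.

(** All of [s] is algebraic over [t] and the coordinates of the vertices outside [A], which number
    two for each such vertex. *)
Lemma rank_dist (t : seq C) (A : seq T) : uniq A ->
  (forall x, x \in A -> acl t (q x).1 /\ acl t (q x).2) ->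
  (rank s + 2 * size A <= rank t + 2 * #|T|)%N.
Proof.
move=> uA At; pose B := enum [predC mem A].
have sz : (size A + size B = #|T|)%N by rewrite -(cardC (mem A)) (card_uniqP uA) -cardE.
pose S := flatten [seq [:: (q x).1; (q x).2] | x <- B].
have szS : size S = (2 * size B)%N.
  by rewrite /S; elim: (B) => //= x r ->; rewrite mulnS.
have xS x : acl (S ++ t) (q x).1 /\ acl (S ++ t) (q x).2.
  have [xA|xA] := boolP (x \in A).
    have tSt z : z \in t -> z \in S ++ t by rewrite mem_cat orbC => ->.
    by have [? ?] := At x xA; split; apply: acl_sub tSt _.
  suff xS z : z \in [:: (q x).1; (q x).2] -> acl (S ++ t) z.
    by split; apply: xS; rewrite !inE eqxx ?orbT.
  move=> zx; apply: mem_acl; rewrite mem_cat; apply/orP; left.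
  by apply/flatten_mapP; exists x => //; rewrite mem_enum.
have sSt : (rank s <= rank (S ++ t))%N.
  apply: rank_le => a /sD[x [y ->]]; have acK := acfield_acl (S ++ t).
  have [? ?] := xS x; have [? ?] := xS y.
  by apply: (acM acK); apply: (acB acK).
have := rank_over_size t S; rewrite rank_cat in sSt; rewrite szS => St.
lia.
Qed.

End RankOfDistances.

Lemma dist_transcendental (C : fieldType) (T : finType) (q : T -> C * C) (s : seq C)
    (u v : T) :
  (forall a, a \in s -> exists x y, a = dist q x y) ->
  (2 * #|T| <= rank s + 3)%N -> u != v -> ~ acl [::] (dist q u v).
Proof.
move=> sD s_rank uv Kd.
have [q' qq' [q'u q'v1 q'v2]] := degenerate_based q u v.
have acK := acfield_acl [:: dist q u v].
have Kd' : acl [:: dist q u v] (dist q u v) by apply: mem_acl; rewrite inE.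
have : (rank s + 2 * size [:: u; v] <= rank [:: dist q u v] + 2 * #|T|)%N.
  apply: (@rank_dist _ _ q').
  - by move=> a /sD[x [y ->]]; exists x, y; rewrite qq'.
  - by rewrite /= inE uv.
  - move=> x; rewrite !inE => /orP[]/eqP->.
      by rewrite q'u; split; exact: (ac0 acK).
    split; [case: q'v1|case: q'v2] => -> //.
    + exact: (ac0 acK).
    + exact: (ac1 acK).
    + exact: (ac0 acK).
(* An algebraic distance has rank 0, so the count gives [rank s + 4 <= 2 * #|T|], off by one from
   the hypothesis. *)
have /asboolP := Kd; rewrite rank1 /= => -> /=; move: (rank s) #|T| s_rank => a b; lia.
Qed.

(** Collinearity would leave only the two parameters [(q x).1] and [d] for three vertices, one fewer
    than the rank requires. *)
Lemma dist_noncollinear (C : fieldType) (T : finType) (q : T -> C * C) (s : seq C)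
    (u v x : T) (d : C) :
  (forall a, a \in s -> exists x y, a = dist q x y) ->
  (2 * #|T| <= rank s + 3)%N -> based q u v d -> uniq [:: u; v; x] ->
  (q x).2 != (q x).1 * d.
Proof.
move=> sD s_rank [qu qv] uvx; apply/eqP => qx.
have acK := acfield_acl [:: (q x).1; d].
have Kx : acl [:: (q x).1; d] (q x).1 by apply: mem_acl; rewrite inE eqxx.
have Kd : acl [:: (q x).1; d] d by apply: mem_acl; rewrite !inE eqxx orbT.
have : (rank s + 2 * size [:: u; v; x] <= rank [:: (q x).1; d] + 2 * #|T|)%N.
  apply: (rank_dist sD uvx) => y; rewrite !inE => /or3P[]/eqP->.
  - by rewrite qu; split; exact: (ac0 acK).
  - by rewrite qv; split; [exact: (ac1 acK)|].
  - by rewrite qx; split=> //; exact: (acM acK).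
have /= := rank_size [:: (q x).1; d].
move: (rank [:: _; _]) (rank s) #|T| s_rank => a b c; lia.
Qed.

(** * Glueing *)

Section EdgeLists.
Variables (C : fieldType) (T : finType).

Definition edge_list (E : rel T) (s : seq (T * T)) : Prop :=
  forall x y, E x y <-> (x, y) \in s \/ (y, x) \in s.

Definition lengths (l : T -> T -> C) (s : seq (T * T)) : seq C :=
  [seq l e.1 e.2 | e <- s].

Definition realises (E : rel T) (l : T -> T -> C) (q : T -> C * C) : Prop :=
  forall x y, E x y -> dist q x y = l x y.

(** An algebraic form of rigidity; nonzero distances make it possible to normalise at any two
    vertices. *)
Definition distances_algebraic (s : seq (T * T)) : Prop :=
  forall q : T -> C * C, (forall x y, x != y -> dist q x y != 0) ->
  forall x y, acl (lengths (dist q) s) (dist q x y).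

(** The lengths are arbitrary apart from their transcendence degree, because this is all that the
    induction can ensure for a length imposed by glueing. *)
Definition realisation_count (E : rel T) (s : seq (T * T)) (N : nat) : Prop :=
  forall l : T -> T -> C, (forall x y, l x y = l y x) ->
  (2 * #|T| <= rank (lengths l s) + 3)%N ->
  exists qs : 'I_N -> T -> C * C,
    [/\ forall k, realises E l (qs k),
        forall k k', dist (qs k) =2 dist (qs k') -> k = k' &
        forall q, realises E l q -> exists k, dist q =2 dist (qs k)].

Lemma realisation_count_fin (I : finType) (E : rel T) (l : T -> T -> C) :
  (exists qs : I -> T -> C * C,
    [/\ forall k, realises E l (qs k),
        forall k k', dist (qs k) =2 dist (qs k') -> k = k' &
        forall q, realises E l q -> exists k, dist q =2 dist (qs k)]) ->
  exists qs : 'I_#|I| -> T -> C * C,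
    [/\ forall k, realises E l (qs k),
        forall k k', dist (qs k) =2 dist (qs k') -> k = k' &
        forall q, realises E l q -> exists k, dist q =2 dist (qs k)].
Proof.
move=> [qs [r_qs inj_qs all_qs]]; exists (fun k => qs (enum_val k)); split=> //.
  by move=> k k' /inj_qs/enum_val_inj.
by move=> q /all_qs[k qk]; exists (enum_rank k); rewrite enum_rankK.
Qed.

Lemma edge_listP E s e : edge_list E s -> e \in s -> E e.1 e.2.
Proof. by case: e => x y /(_ x y) Es ?; apply/Es; left. Qed.

Lemma realises_lengths E s l q : edge_list E s -> realises E l q ->
  forall a, a \in lengths l s -> exists x y, a = dist q x y.
Proof.
move=> Es ql a /mapP[e es ->]; exists e.1, e.2.
by rewrite ql //; exact: edge_listP es.
Qed.

Lemma third_vertex (u v : T) : u != v -> (2 < #|T|)%N -> exists x, uniq [:: u; v; x].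
Proof.
move=> uv T3; have [x xuv|none] := pickP [pred x | x \notin [:: u; v]].
  exists x; move: xuv; rewrite /= !inE !negb_or => /andP[xu xv].
  by rewrite uv (eq_sym u) xu (eq_sym v) xv.
move: T3; rewrite ltnNge -[X in (_ <= X)%N]/(size [:: u; v]).
have : (#|T| <= #|[:: u; v]|)%N.
  by apply/subset_leq_card/subsetP => x _; apply: contraFT (none x) => /= ->.
by move=> /leq_trans/(_ (card_size _)) ->.
Qed.

End EdgeLists.

Section Glue.
Variables (C : numClosedFieldType) (T1 T2 T : finType).
Variables (E1 : rel T1) (E2 : rel T2) (E : rel T).
Variables (s1 : seq (T1 * T1)) (s2 : seq (T2 * T2)).
Variables (u1 v1 : T1) (u2 v2 : T2) (f1 : T1 -> T) (f2 : T2 -> T).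
Hypotheses (f1_inj : injective f1) (f2_inj : injective f2).
Hypotheses (fu : f1 u1 = f2 u2) (fv : f1 v1 = f2 v2) (uv1 : u1 != v1).
Hypothesis f12 : forall a b, f1 a = f2 b -> (a = u1 /\ b = u2) \/ (a = v1 /\ b = v2).
Hypothesis f12_onto : forall x, (exists a, x = f1 a) \/ (exists b, x = f2 b).

Definition other (a b : T2) : bool :=
  ~~ (((a == u2) && (b == v2)) || ((a == v2) && (b == u2))).

Hypothesis EE : forall x y, E x y <->
  (exists a b, [/\ E1 a b, x = f1 a & y = f1 b]) \/
  (exists a b, [/\ E2 a b, other a b, x = f2 a & y = f2 b]).
Hypotheses (E1s : edge_list E1 s1) (E2s : edge_list E2 s2) (E2uv : E2 u2 v2).

Definition glue_edges : seq (T * T) :=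
  [seq (f1 e.1, f1 e.2) | e <- s1] ++
  [seq (f2 e.1, f2 e.2) | e <- s2 & other e.1 e.2].

Lemma uv2 : u2 != v2.
Proof. by apply: contraNneq uv1 => uv; apply/eqP/f1_inj; rewrite fu fv uv. Qed.

Lemma otherC a b : other a b = other b a.
Proof. by rewrite /other orbC; congr (~~ (_ || _)); exact: andbC. Qed.

Lemma glue_edge_list : edge_list E glue_edges.
Proof.
move=> x y; split=> [/EE[[a [b [ab -> ->]]]|[a [b [ab o -> ->]]]]|].
- by case/E1s: ab => ab; [left|right]; rewrite mem_cat; apply/orP; left;
    apply/mapP; [exists (a, b)|exists (b, a)].
- by case/E2s: ab => ab; [left|right]; rewrite mem_cat; apply/orP; right;
    apply/mapP; [exists (a, b)|exists (b, a)]; rewrite // mem_filter ab /= ?o // otherC o.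
- have sym x' y' : E x' y' -> E y' x'.
    move=> /EE[[a [b [ab -> ->]]]|[a [b [ab o -> ->]]]]; apply/EE; [left|right];
      exists b, a; split=> //; rewrite ?(otherC b) //.
      by apply/E1s; case/E1s: ab; [right|left].
    by apply/E2s; case/E2s: ab; [right|left].
  have gE x' y' : (x', y') \in glue_edges -> E x' y'.
    rewrite mem_cat => /orP[] /mapP[[a b]]; [move=> ab|rewrite mem_filter => /andP[o ab]];
      move=> [-> ->]; apply/EE; [left|right]; exists a, b; split=> //.
      by apply/E1s; left.
    by apply/E2s; left.
  by case=> /gE // /sym.
Qed.

Lemma card_glue : (#|T| + 2 = #|T1| + #|T2|)%N.
Proof.
pose A := f1 @: [set: T1]; pose B := f2 @: [set: T2].
have cA : #|A| = #|T1| by rewrite card_imset // cardsT.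
have cB : #|B| = #|T2| by rewrite card_imset // cardsT.
have AB : A :|: B = setT.
  apply/setP => x; rewrite !inE; apply/orP.
  by case: (f12_onto x) => -[a ->]; [left|right]; apply/imsetP; exists a.
have AiB : A :&: B = [set f1 u1; f1 v1].
  apply/setP => x; rewrite !inE; apply/andP/orP.
    move=> [/imsetP[a _ ->] /imsetP[b _ /f12[[-> _]|[-> _]]]]; by [left|right].
  by case=> /eqP->; split; apply/imsetP; [exists u1|exists u2|exists v1|exists v2].
have := cardsUI A B; rewrite AB AiB cA cB cardsT cards2 => <-.
by rewrite (inj_eq f1_inj) uv1.
Qed.

Lemma count_other : (count (fun e => other e.1 e.2) s2 < size s2)%N.
Proof.
rewrite -(count_predC (fun e => other e.1 e.2) s2) -[X in (X < _)%N]addn0 ltn_add2l.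
rewrite -has_count; apply/hasP; case/E2s: E2uv => uvs;
  by [exists (u2, v2); rewrite //= /other !eqxx|exists (v2, u2); rewrite //= /other !eqxx orbT].
Qed.

(** At least one entry is dropped, and (2a - 3) + (2b - 3) - 1 = 2(a + b - 2) - 3 for a and b the
    numbers of vertices of the two graphs. *)
Lemma size_glue_edges : (size s1 + 3 <= 2 * #|T1|)%N -> (size s2 + 3 <= 2 * #|T2|)%N ->
  (size glue_edges + 3 <= 2 * #|T|)%N.
Proof.
move=> z1 z2; rewrite size_cat !size_map size_filter; have := count_other.
have := card_glue; move: (count _ s2) (size s2) #|T| #|T1| #|T2| z2 z1 => a b c d f; lia.
Qed.

Section Glueing.
Variables (q1 : T1 -> C * C) (q2 : T2 -> C * C).
Hypotheses (qu : q1 u1 = q2 u2) (qv : q1 v1 = q2 v2).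

(** On the two common vertices [q1] and [q2] agree; the default 0 is never reached, as the two
    images cover [T]. *)
Definition glue (x : T) : C * C :=
  if [pick a | f1 a == x] is Some a then q1 a
  else if [pick b | f2 b == x] is Some b then q2 b else 0.

Lemma glue1 a : glue (f1 a) = q1 a.
Proof.
rewrite /glue; case: pickP => [b /eqP/f1_inj -> //|/(_ a)].
by rewrite eqxx.
Qed.

Lemma glue2 b : glue (f2 b) = q2 b.
Proof.
rewrite /glue; case: pickP => [a /eqP/f12[[-> ->]|[-> ->]] //|_].
by case: pickP => [c /eqP/f2_inj -> //|/(_ b)]; rewrite eqxx.
Qed.

End Glueing.

(** The first graph supplies the length of the deleted edge, and with it the second graph supplies
    its own distances. Each vertex then has algebraic distances to the two common vertices, hence
    algebraic normalised coordinates, which gives the mixed distances. *)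
Lemma glue_distances_algebraic :
  @distances_algebraic C T1 s1 -> @distances_algebraic C T2 s2 ->
  @distances_algebraic C T glue_edges.
Proof.
move=> alg1 alg2 q q0; pose L := lengths (dist q) glue_edges.
have acK := acfield_acl L.
have K1 a b : acl L (dist q (f1 a) (f1 b)).
  apply: (@acl_trans _ (lengths (dist (q \o f1)) s1)); last first.
    by apply: alg1 => x y xy; apply: q0; rewrite (inj_eq f1_inj).
  move=> _ /mapP[e es ->]; apply: mem_acl; apply/mapP; exists (f1 e.1, f1 e.2) => //.
  by rewrite mem_cat; apply/orP; left; apply/mapP; exists e.
have K2 a b : acl L (dist q (f2 a) (f2 b)).
  apply: (@acl_trans _ (lengths (dist (q \o f2)) s2)); last first.
    by apply: alg2 => x y xy; apply: q0; rewrite (inj_eq f2_inj).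
  move=> _ /mapP[e es ->]; have [o|] := boolP (other e.1 e.2).
    apply: mem_acl; apply/mapP; exists (f2 e.1, f2 e.2) => //.
    by rewrite mem_cat; apply/orP; right; apply/mapP; exists e; rewrite // mem_filter o.
  rewrite negbK => /orP[] /andP[/eqP-> /eqP->].
    by have := K1 u1 v1; rewrite fu fv.
  by have := K1 v1 u1; rewrite fu fv.
have d0 : dist q (f1 u1) (f1 v1) != 0 by apply: q0; rewrite (inj_eq f1_inj).
have Kc x : acl L (normalise q (f1 u1) (f1 v1) x).1 /\
            acl L (normalise q (f1 u1) (f1 v1) x).2.
  apply: (based_acl acK (normalise_based d0) d0 (K1 _ _)); rewrite dist_normalise //;
    by case: (f12_onto x) => -[a ->]; rewrite ?fu ?fv //; rewrite -?fu -?fv.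
move=> x y; rewrite -(dist_normalise x y d0).
have [? ?] := Kc x; have [? ?] := Kc y.
by apply: (acM acK); apply: (acB acK).
Qed.

(** * Counting the realisations of a glued graph *)

Section Count.
Variables (N1 N2 : nat) (l : T -> T -> C).
Hypotheses (T1_card : (2 < #|T1|)%N) (T2_card : (2 < #|T2|)%N).
Hypotheses (s1_size : (size s1 + 3 <= 2 * #|T1|)%N) (s2_size : (size s2 + 3 <= 2 * #|T2|)%N).
Hypotheses (alg1 : @distances_algebraic C T1 s1).
Hypotheses (count1 : @realisation_count C T1 E1 s1 N1) (count2 : @realisation_count C T2 E2 s2 N2).
Hypothesis lC : forall x y, l x y = l y x.
Hypothesis l_rank : (2 * #|T| <= rank (lengths l glue_edges) + 3)%N.

Let l1 a b := l (f1 a) (f1 b).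
(* [d] will be the distance between [u1] and [v1] in a realisation of the first
   graph, imposed on the edge [u2 v2] deleted from the second one. *)
Definition length2 (d : C) a b := if other a b then l (f2 a) (f2 b) else d.

Let L1 := lengths l1 s1.
Let L2 := [seq l (f2 e.1) (f2 e.2) | e <- s2 & other e.1 e.2].

Lemma glue_lengthsE : lengths l glue_edges = L1 ++ L2.
Proof. by rewrite /lengths map_cat -!map_comp. Qed.

Lemma L2_size : (size L2 + 4 <= 2 * #|T2|)%N.
Proof.
rewrite size_map size_filter; have := count_other.
by move: s2_size; move: (count _ s2) (size s2) #|T2| => a b c; lia.
Qed.

(** With a, b and n = a + b - 2 vertices in the two graphs and the result, at most 2b - 4 lengths
    come from the second graph, and (2n - 3) - (2b - 4) = 2a - 3. *)
Lemma L1_rank : (2 * #|T1| <= rank L1 + 3)%N.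
Proof.
have := l_rank; rewrite glue_lengthsE (rank_overC [::] L1 L2 : rank _ = rank _) rank_cat.
have := rank_over_size L1 L2; have := L2_size; have := card_glue.
move: (size L2) (rank_over _ _) (rank _) #|T| #|T1| #|T2| => a b c d f g; lia.
Qed.

(** [L1] has at most 2a - 3 entries, so [L2] has rank at least 2b - 4 over [L1], hence also over
    [d], which is algebraic over [L1]; the transcendental [d] itself adds one. *)
Lemma length2_rank d : acl L1 d -> ~ acl [::] d ->
  (2 * #|T2| <= rank (lengths (length2 d) s2) + 3)%N.
Proof.
move=> L1d d_trans.
have sub : (rank (L2 ++ [:: d]) <= rank (lengths (length2 d) s2))%N.
  apply: rank_le => a; rewrite mem_cat => /orP[/mapP[e]|].
    rewrite mem_filter => /andP[o es] ->; apply: mem_acl; apply/mapP; exists e => //.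
    by rewrite /length2 o.
  rewrite inE => /eqP->; apply: mem_acl; apply/mapP.
  by case/E2s: E2uv => uvs; [exists (u2, v2)|exists (v2, u2)];
    rewrite // /length2 /other /= !eqxx ?orbT.
have anti : (rank_over L1 L2 <= rank_over [:: d] L2)%N.
  by apply: rank_over_anti => y; rewrite inE => /eqP->.
have /asboolPn d_rank := d_trans.
move: sub; rewrite rank_cat rank1 d_rank /=.
have := l_rank; rewrite glue_lengthsE (rank_overC [::] L1 L2 : rank _ = rank _) rank_cat.
have := rank_size L1; have := card_glue; rewrite size_map.
move: anti s1_size; rewrite -/L1.
move: (size s1) (rank_over _ _) (rank_over _ _) (rank _) (rank _) #|T| #|T1| #|T2|.
by move=> a b c d' f g h k; lia.
Qed.

Lemma glue_count : exists qs : 'I_N1 * 'I_N2 * bool -> T -> C * C,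
  [/\ forall k, realises E l (qs k),
      forall k k', dist (qs k) =2 dist (qs k') -> k = k' &
      forall q, realises E l q -> exists k, dist q =2 dist (qs k)].
Proof.
have l1C a b : l1 a b = l1 b a by exact: lC.
have [qs1 [r1 inj1 all1]] := count1 l1C L1_rank.
pose d i := dist (qs1 i) u1 v1.
have D1 i := realises_lengths E1s (r1 i).
have tr1 i x y : x != y -> ~ acl [::] (dist (qs1 i) x y).
  exact: dist_transcendental (D1 i) L1_rank.
have nz (x : C) : ~ acl [::] x -> x != 0.
  by move=> xK; apply/eqP => x0; apply: xK; rewrite x0; exact: ac0 (acfield_acl _).
have d_trans i : ~ acl [::] (d i) by exact: tr1.
have d0 i : d i != 0 by exact/nz/d_trans.
have dL1 i : acl L1 (d i).
  have -> : L1 = lengths (dist (qs1 i)) s1.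
    by apply/eq_in_map => e /(edge_listP E1s)/(r1 i) ->.
  by apply: alg1 => x y /(tr1 i)/nz.
have l2C i a b : length2 (d i) a b = length2 (d i) b a by rewrite /length2 otherC (lC (f2 a)).
have rk2 i := length2_rank (dL1 i) (@d_trans i).
have /choice[qs2 qs2P] i := count2 (l2C i) (rk2 i).
have r2 i j := let: And3 h _ _ := qs2P i in h j.
have d2 i j : dist (qs2 i j) u2 v2 = d i.
  by rewrite (r2 i j) // /length2 /other !eqxx.
pose n1 i := normalise (qs1 i) u1 v1; pose n2 i j := normalise (qs2 i j) u2 v2.
have b1 i : based (n1 i) u1 v1 (d i) by exact: (normalise_based (d0 i)).
have dn1 i x y : dist (n1 i) x y = dist (qs1 i) x y by exact: (dist_normalise _ _ (d0 i)).
have b2 i j : based (n2 i j) u2 v2 (d i).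
  by rewrite -(d2 i j); apply: normalise_based; rewrite d2.
have dn2 i j x y : dist (n2 i j) x y = dist (qs2 i j) x y.
  by apply: dist_normalise; rewrite d2.
(* Both parts are now based at the same two points; the boolean decides whether the second is
   reflected before glueing. *)
pose m2 i j b := if b then mirror (d i) (n2 i j) else n2 i j.
have bm i j b : based (m2 i j b) u2 v2 (d i).
  by rewrite /m2; case: b => //; exact: mirror_based.
have dm2 i j b x y : dist (m2 i j b) x y = dist (qs2 i j) x y.
  by rewrite /m2 -dn2; case: b; rewrite ?dist_mirror.
pose g (k : 'I_N1 * 'I_N2 * bool) := glue (n1 k.1.1) (m2 k.1.1 k.1.2 k.2).
have g1 k a : g k (f1 a) = n1 k.1.1 a by exact: glue1.
have g2 k b : g k (f2 b) = m2 k.1.1 k.1.2 k.2 b.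
  have [n1u n1v] := b1 k.1.1; have [m2u m2v] := bm k.1.1 k.1.2 k.2.
  by apply: glue2; rewrite ?n1u ?n1v ?m2u ?m2v.
have dg1 k a b : dist (g k) (f1 a) (f1 b) = dist (qs1 k.1.1) a b.
  by rewrite -dn1 /dist !g1.
have dg2 k a b : dist (g k) (f2 a) (f2 b) = dist (qs2 k.1.1 k.1.2) a b.
  by rewrite -(dm2 _ _ k.2) /dist !g2.
exists g; split.
- move=> k x y /EE[[a [b [ab -> ->]]]|[a [b [ab o -> ->]]]].
    by rewrite dg1; exact: r1.
  by rewrite dg2 (r2 _ _ _ _ ab) /length2 o.
- move=> [[i j] b] [[i' j'] b'] e.
  have ii' : i = i'.
    by apply: inj1 => x y; have := e (f1 x) (f1 y); rewrite !dg1.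
  subst i'; have jj' : j = j'.
    have [_ inj2 _] := qs2P i.
    by apply: inj2 => x y; have := e (f2 x) (f2 y); rewrite !dg2.
  subst j'; congr (_, _, _).
  (* A vertex of each graph off the common line: the distance between these two reveals whether the
     second part was reflected. *)
  have [a ua] := third_vertex uv1 T1_card; have [c uc] := third_vertex uv2 T2_card.
  have ha : (n1 i a).2 != (n1 i a).1 * d i.
    apply: (dist_noncollinear _ L1_rank (b1 i) ua) => x /(D1 i)[y [z ->]].
    by exists y, z; rewrite dn1.
  have hc : (n2 i j c).2 != (n2 i j c).1 * d i.
    apply: (dist_noncollinear _ (rk2 i) (b2 i j) uc) => x.
    move=> /(realises_lengths E2s (r2 i j))[y [z ->]].
    by exists y, z; rewrite dn2.
  have := e (f1 a) (f2 c); rewrite /dist !g1 !g2 /m2 /=.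
  have cross := based_cross (z := (n1 i a).1) (w := (n1 i a).2)
    (z' := (n2 i j c).1) (w' := (n2 i j c).2) (d0 i).
  case: b b' {e} => -[] //= e.
    by case: (cross (esym e)) => /eqP; [rewrite (negPf ha)|rewrite (negPf hc)].
  by case: (cross e) => /eqP; [rewrite (negPf ha)|rewrite (negPf hc)].
- move=> q qE.
  have [i qi] : exists i, dist (q \o f1) =2 dist (qs1 i).
    by apply: all1 => a b ab; apply: qE; apply/EE; left; exists a, b.
  have duv : dist q (f1 u1) (f1 v1) = d i by exact: qi u1 v1.
  have duv0 : dist q (f1 u1) (f1 v1) != 0 by rewrite duv.
  have [j qj] : exists j, dist (q \o f2) =2 dist (qs2 i j).
    have [_ _ all2] := qs2P i; apply: all2 => a b ab; rewrite /length2.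
    have [o|] := boolP (other a b); first by apply: qE; apply/EE; right; exists a, b.
    rewrite negbK -duv fu fv => /orP[] /andP[/eqP-> /eqP->] //.
    by rewrite distC.
  pose p := normalise q (f1 u1) (f1 v1).
  (* If the first part of [p] is the mirror image of [n1 i], all of [p] is reflected; only the
     second part can then still differ by a reflection. *)
  have [p' dp' p'1] : exists2 p', dist p' =2 dist q & forall a, p' (f1 a) = n1 i a.
    have bp : based (p \o f1) u1 v1 (d i) by rewrite -duv; exact: (normalise_based duv0).
    have dp x y : dist p x y = dist q x y by exact: (dist_normalise _ _ duv0).
    have [pn|pn] : p \o f1 =1 n1 i \/ p \o f1 =1 mirror (d i) (n1 i).
    + apply: (based_congruent (b1 i) bp (d0 i)) => x y.
      by rewrite dn1 -qi; exact: esym (dp _ _).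
    + by exists p.
    + exists (mirror (d i) p) => [x y|a]; first by rewrite dist_mirror.
      rewrite -[RHS](mirrorK (n1 i) (d0 i) a); have /= pa := pn a.
      by rewrite {1}/mirror pa.
  have [n1u n1v] := b1 i.
  have bp2 : based (p' \o f2) u2 v2 (d i) by split=> /=; rewrite -?fu -?fv p'1.
  have [b p'2] : exists b, p' \o f2 =1 m2 i j b.
    have [|pn|pn] := based_congruent (b2 i j) bp2 (d0 i).
    + by move=> x y; rewrite dn2 -qj; exact: esym (dp' _ _).
    + by exists false.
    + by exists true.
  exists (i, j, b) => x y; rewrite -dp'.
  have p'g z : p' z = g (i, j, b) z.
    by case: (f12_onto z) => -[a ->]; [rewrite g1 p'1|rewrite g2 -p'2].
  by rewrite /dist !p'g.
Qed.

End Count.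
End Glue.

(** * The triangle, and the induction over the family *)

Section Triangle.
Variables (C : numClosedFieldType) (E : rel 'I_3).
Hypothesis EK3 : forall x y, E x y = (x != y).

Definition triangle_edges : seq ('I_3 * 'I_3) :=
  [:: (ord0, inord 1); (inord 2, ord0); (inord 2, inord 1)].

Lemma triangle_edge_list : edge_list E triangle_edges.
Proof.
move=> x y; rewrite EK3 !inE !xpair_eqE -!val_eqE /= !inordK //.
case: x y => [[|[|[|//]]] ?] [[|[|[|//]]] ?] /=; split=> //; first [by left|by right|by case].
Qed.

Lemma triangle_distances (P : 'I_3 -> 'I_3 -> Prop) :
  (forall x, P x x) -> (forall x y, P x y -> P y x) ->
  (forall e, e \in triangle_edges -> P e.1 e.2) -> forall x y, P x y.
Proof.
move=> Pxx PC Ps x y; have [->//|xy] := eqVneq x y.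
have : E x y by rewrite EK3.
by case/triangle_edge_list => /Ps //; exact: PC.
Qed.

Lemma triangle_distances_algebraic : distances_algebraic C triangle_edges.
Proof.
move=> q _; apply: triangle_distances => [x|x y|e es].
- by rewrite distxx; exact: ac0 (acfield_acl _).
- by rewrite distC.
- by apply: mem_acl; exact: (map_f (fun e => dist q e.1 e.2)).
Qed.

Lemma triangle_count : realisation_count C E triangle_edges 1.
Proof.
move=> l lC; rewrite card_ord /lengths /= => l_rank.
set d := l ord0 _ in l_rank; set a := l _ ord0 in l_rank; set c := l _ (inord 1) in l_rank.
(* The hypothesis asks for rank 3, whereas a zero length would leave at most the rank of the other
   two. *)
have d0 : d != 0.
  apply/eqP => dE; move: l_rank; rewrite -[[:: d; a; c]]/([:: d] ++ [:: a; c]) rank_cat.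
  rewrite rank_over0; last first.
    by move=> y; rewrite inE dE => /eqP->; exact: ac0 (acfield_acl _).
  by have /= := rank_size [:: a; c]; move: (rank _) => r; lia.
(* The apex (z, w) over the base (0, 0), (1, d) must satisfy zw = a and w = b - dz, so z is a root
   of dz^2 - bz + a. *)
pose b := a + d - c; pose r := sqrtC (b ^+ 2 - 4 * a * d).
pose z := (b + r) / (2 * d); pose w := b - d * z.
have two : (2 : C) != 0 by rewrite pnatr_eq0.
have zw : z * w = a.
  have rr : r ^+ 2 = b ^+ 2 - 4 * a * d by exact: sqrtCK.
  have -> : z * w = (b ^+ 2 - r ^+ 2) / (4 * d).
    by rewrite /w /z; field.
  by rewrite rr; field.
pose q (x : 'I_3) : C * C := nth 0 [:: (0, 0); (1, d); (z, w)] x.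
have qE : realises E l q.
  move=> x y; rewrite EK3.
  apply: (triangle_distances (P := fun x y => x != y -> dist q x y = l x y)).
  - by move=> x'; rewrite eqxx.
  - by move=> x' y' h; rewrite eq_sym => /h; rewrite distC lC.
  move=> e; rewrite !inE => /or3P[]/eqP-> _; rewrite /dist /q /= !inordK //=.
  - by rewrite /d; ring.
  - by rewrite !subr0 zw.
  - have -> : (z - 1) * (w - d) = z * w - d * z - w + d by ring.
    by rewrite zw -/c /w /b; ring.
exists (fun _ => q); split=> //; first by move=> k k' _; rewrite !ord1.
move=> q' q'E; exists ord0 => x y.
have [->|xy] := eqVneq x y; first by rewrite !distxx.
by rewrite q'E ?qE // EK3.
Qed.

End Triangle.

Lemma inQ_counted (C : numClosedFieldType) (n : nat) (E : rel 'I_n) : inQ E ->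
  (2 < #|'I_n|)%N /\
  exists s, [/\ edge_list E s, (size s + 3 <= 2 * #|'I_n|)%N,
                distances_algebraic C s &
                realisation_count C E s (2 ^ (#|'I_n| - 3))].
Proof.
elim=> {n E} [E EK3|n1 E1 n2 E2 m E u1 v1 u2 v2 f1 f2 _ [T1 [s1 [Es1 z1 alg1 c1]]]
    _ [T2 [s2 [Es2 z2 alg2 c2]]] uv1 E2uv [f1i [f2i [fu [fv [f12 [onto EE]]]]]]].
  split; first by rewrite card_ord.
  exists triangle_edges; split.
  - exact: triangle_edge_list.
  - by rewrite card_ord.
  - exact: triangle_distances_algebraic EK3.
  - by rewrite card_ord; exact: triangle_count.
have card := card_glue f1i f2i fu fv uv1 f12 onto.
split; first by move: card T1 T2; move: #|_| #|_| #|_| => a b c; lia.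
exists (glue_edges s1 s2 u2 v2 f1 f2); split.
- exact: (glue_edge_list EE Es1 Es2).
- exact: (size_glue_edges f1i f2i fu fv uv1 f12 onto Es2 E2uv z1 z2).
- exact: (glue_distances_algebraic f1i f2i fu fv uv1 onto alg1 alg2).
move=> l lC l_rank.
have -> : (2 ^ (#|'I_m| - 3) = #|{: 'I_(2 ^ (#|'I_n1| - 3)) * 'I_(2 ^ (#|'I_n2| - 3)) * bool}|)%N.
  (* The reflection adds one to the exponent: (a - 3) + (b - 3) + 1 = (a + b - 2) - 3, without
     truncation since both graphs have more than two vertices. *)
  rewrite 2!card_prod card_bool 2!(card_ord (2 ^ _)) -expnD -expnSr; congr (2 ^ _)%N.
  by move: card T1 T2; move: #|_| #|_| #|_| => a b c; lia.
apply: realisation_count_fin.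
exact: (glue_count f1i f2i fu fv uv1 f12 onto EE Es1 Es2 E2uv T1 T2 z1 z2 alg1 c1 c2 lC l_rank).
Qed.

(** * Generic realisations *)

(** In characteristic zero the naturals below [size p] are distinct, and too many to be all
    roots. *)
Lemma poly_nonroot (F : numDomainType) (p : {poly F}) : p != 0 -> exists c, p.[c] != 0.
Proof.
move=> p0; apply: contrapT => none.
suff : (size [seq n%:R : F | n <- iota 0 (size p)] < size p)%N.
  by rewrite size_map size_iota ltnn.
apply: max_poly_roots => //.
  apply/allP => c _; rewrite rootE; apply: contrapT => /negP pc.
  by apply: none; exists c.
by rewrite map_inj_uniq ?iota_uniq // => m n /eqP; rewrite eqr_nat => /eqP.
Qed.

Section Generic.
Variables (C : numClosedFieldType) (N : nat) (v : 'I_N -> C).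
Hypothesis v_generic : forall P : {mpoly rat[N]}, P != 0 ->
  (map_mpoly (ratr : rat -> C) P).@[v] != 0.

(* The values of polynomials in the [v j] with [j != k] form a subring. An
   algebraic relation for [v k] over it is the specialisation at [v] of a
   polynomial, nonzero since it does not vanish identically along the line
   through [v] on which only the [k]-th coordinate varies. *)
Lemma generic_transcendental (k : 'I_N) :
  ~ acl [seq v j | j <- rem k (enum 'I_N)] (v k).
Proof.
pose vc c : 'I_N -> C := fun j => if j == k then c else v j.
pose ev c (P : {mpoly rat[N]}) : C := (map_mpoly (ratr : rat -> C) P).@[vc c].
(* A value that is the same for every [c] stands in for a polynomial not involving the variable of
   index [k]. *)
pose S a := exists P, forall c, ev c P = a.
have S1 : S 1 by exists 1 => c; rewrite /ev !rmorph1.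
have SB x y : S x -> S y -> S (x - y).
  by move=> [P Px] [Q Qy]; exists (P - Q) => c; rewrite -(Px c) -(Qy c) /ev !rmorphB.
have SM x y : S x -> S y -> S (x * y).
  by move=> [P Px] [Q Qy]; exists (P * Q) => c; rewrite -(Px c) -(Qy c) /ev !rmorphM.
move=> /(_ _ (acfield_algebraic_over S1 SB SM))[].
  move=> y /mapP[j]; rewrite mem_rem_uniq ?enum_uniq // inE => /andP[jk _] ->.
  apply: algebraic_over_id => //; exists 'X_j => c.
  by rewrite /ev map_mpolyX mevalXU /vc (negPf jk).
move=> p [p0 /choice[A Ap] pv].
pose P : {mpoly rat[N]} := \sum_(i < size p) A i * 'X_k ^+ i.
have PE c : ev c P = p.[c].
  rewrite -[ev c P]/((meval (vc c) \o map_mpoly (ratr : rat -> C)) P).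
  rewrite rmorph_sum horner_coef; apply: eq_bigr => i _.
  by rewrite rmorphM rmorphXn /= map_mpolyX mevalXU /vc eqxx -(Ap i c).
have P0 : P != 0.
  have [c pc] := poly_nonroot p0.
  by apply: contraNneq pc => P0; rewrite -PE P0 /ev !rmorph0.
have vE : vc (v k) = v by apply/funext => j; rewrite /vc; case: eqP => [->|].
have := PE (v k); rewrite /ev vE (rootP pv) => Pv.
by have := v_generic P0; rewrite Pv eqxx.
Qed.

Lemma generic_rank : rank [seq v k | k <- enum 'I_N] = N.
Proof.
rewrite rank_free ?enum_uniq ?size_enum_ord // => k _.
exact: generic_transcendental.
Qed.

End Generic.

(** * Passage between Euclidean and isotropic coordinates *)

Section Realisations.
Variables (C : numClosedFieldType) (n : nat).
Implicit Types (p : 'M[C]_(n, 2)) (q : 'I_n -> C * C).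

Definition isotropic p : 'I_n -> C * C :=
  fun x => (p x 0 + 'i * p x 1, p x 0 - 'i * p x 1).

Definition cartesian q : 'M[C]_(n, 2) :=
  \matrix_(x, j) if j == 0 then ((q x).1 + (q x).2) / 2
                 else ((q x).1 - (q x).2) / (2 * 'i).

Lemma sqd_isotropic p x y : sqd p x y = dist (isotropic p) x y.
Proof.
rewrite /sqd /dist big_ord_recl big_ord1 /=.
rewrite [lift ord0 ord0](_ : _ = 1); last exact/val_inj.
rewrite [X in _ = X](_ : _ = (p x 0 - p y 0) ^+ 2 - 'i ^+ 2 * (p x 1 - p y 1) ^+ 2); last by ring.
by rewrite sqrCi; ring.
Qed.

Lemma isotropicK p : cartesian (isotropic p) = p.
Proof.
have i0 := neq0Ci C.
apply/matrixP => x j; rewrite mxE /=; have [->|j0] := eqVneq j 0.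
  by field.
have -> : j = 1 by case: j j0 => -[|[|//]] ? // _; exact/val_inj.
by field.
Qed.

Lemma cartesianK q : isotropic (cartesian q) =1 q.
Proof.
have i0 := neq0Ci C.
move=> x; rewrite /isotropic !mxE /= [RHS]surjective_pairing.
by congr (_, _); field.
Qed.

Lemma sqd_cartesian q x y : sqd (cartesian q) x y = dist q x y.
Proof. by rewrite sqd_isotropic /dist !cartesianK. Qed.

Lemma ac_imaginary (K : C -> Prop) : acfield K -> K 'i.
Proof.
move=> acK; apply: (ac_quadratic acK (ac1 acK) (ac0 acK) (ac1 acK) (oner_neq0 _)).
by rewrite sqrCi; ring.
Qed.

Section GenericRealisation.
Variable p : 'M[C]_(n, 2).
Hypothesis p_generic : forall P : {mpoly rat[n * 2]}, P != 0 ->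
  (map_mpoly (ratr : rat -> C) P).@[fun k => mxvec p 0 k] != 0.

Let v k := mxvec p 0 k.

(** Otherwise [p x 0] would be a root of a monic quadratic polynomial over the closure of the
    remaining coordinates. *)
Lemma generic_dist_neq0 x y : x != y -> dist (isotropic p) x y != 0.
Proof.
move=> xy; rewrite -sqd_isotropic; apply/eqP => d0.
apply: (generic_transcendental p_generic (k := mxvec_index x 0)).
set K := acl _; have acK : acfield K by exact: acfield_acl.
have Kp z j : (z, j) != (x, 0) -> K (p z j).
  move=> zx; apply: mem_acl; apply/mapP; exists (mxvec_index z j); last by rewrite mxvecE.
  rewrite mem_rem_uniq ?enum_uniq // inE mem_enum andbT.
  apply: contra zx => /eqP e; have [g gK _] := curry_mxvec_bij n 2.
  have gE a : g (uncurry (@mxvec_index n 2) a) = a by exact: gK.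
  by rewrite -(gE (z, j)) -(gE (x, 0)) /= e.
have Ky0 : K (p y 0) by apply: Kp; rewrite xpair_eqE eq_sym (negPf xy).
have Ky1 : K (p y 1) by apply: Kp; rewrite xpair_eqE andbF.
have Kx1 : K (p x 1) by apply: Kp; rewrite xpair_eqE andbF.
rewrite mxvecE.
have Kb : K (- 2%:R * p y 0) by apply: (acM acK _ Ky0); apply: (acN acK); exact: (ac_nat acK).
have Kc : K (p y 0 ^+ 2 + (p x 1 - p y 1) ^+ 2).
  by apply: (acD acK); apply: (acX acK) => //; exact: (acB acK).
apply: (ac_quadratic acK (ac1 acK) Kb Kc (oner_neq0 _)).
move: d0; rewrite /sqd big_ord_recl big_ord1.
rewrite [lift ord0 ord0](_ : _ = 1); last exact/val_inj.
move=> d0; rewrite -[RHS]d0; ring.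
Qed.

(* All coordinates are algebraic over the edge lengths together with three
   further coordinates, so genericity forces the lengths to have transcendence
   degree at least [2n - 3]. *)
Lemma generic_lengths_rank (s : seq ('I_n * 'I_n)) : (2 < n)%N ->
  distances_algebraic C s ->
  (2 * n <= rank (lengths (dist (isotropic p)) s) + 3)%N.
Proof.
move=> n2 alg; set q := isotropic p; set L := lengths _ s.
pose x : 'I_n := Ordinal (ltnW (ltnW n2)); pose y : 'I_n := Ordinal (ltnW n2).
have xy : x != y by [].
have d0 := generic_dist_neq0 xy.
(* These determine the isometry that undoes the normalisation: the translation by [q x] and the
   scaling factor [(q y).1 - (q x).1]. *)
pose t := [:: (q x).1; (q x).2; (q y).1].
have acL := acfield_acl L; have acK := acfield_acl (t ++ L).
have LK a : acl L a -> acl (t ++ L) a.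
  by apply: acl_sub => b; rewrite mem_cat orbC => ->.
have tK a : a \in t -> acl (t ++ L) a.
  by move=> ta; apply: mem_acl; rewrite mem_cat ta.
have LD a b : acl L (dist q a b) by apply: alg; exact: generic_dist_neq0.
have Kx1 : acl (t ++ L) (q x).1 by apply: tK; rewrite !inE eqxx.
have Kx2 : acl (t ++ L) (q x).2 by apply: tK; rewrite !inE eqxx orbT.
have Ky1 : acl (t ++ L) (q y).1 by apply: tK; rewrite !inE eqxx !orbT.
have Kyx : acl (t ++ L) ((q y).1 - (q x).1) by exact: (acB acK).
have yx0 : (q y).1 - (q x).1 != 0.
  by move: d0; rewrite mulf_eq0 negb_or subr_eq0 eq_sym -subr_eq0 => /andP[].
have Kq z : acl (t ++ L) (q z).1 /\ acl (t ++ L) (q z).2.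
  have [] := based_acl acL (normalise_based d0) d0 (LD _ _) (x := z).
  - by rewrite dist_normalise.
  - by rewrite dist_normalise.
  move=> /LK K1 /LK K2; split.
  - have -> : (q z).1 = (normalise q x y z).1 * ((q y).1 - (q x).1) + (q x).1.
      by rewrite /= divfK // subrK.
    by apply: (acD acK) => //; exact: (acM acK).
  - have -> : (q z).2 = (normalise q x y z).2 / ((q y).1 - (q x).1) + (q x).2.
      by rewrite /= mulfK // subrK.
    by apply: (acD acK) => //; exact: (ac_div acK).
have : (rank [seq v k | k <- enum 'I_(n * 2)] <= rank (t ++ L))%N.
  apply: rank_le => a /mapP[k _ ->]; rewrite /v.
  case: (mxvec_indexP k) => z j; rewrite mxvecE -{1}(isotropicK p) mxE.
  have [K1 K2] := Kq z; have K2' := ac_nat acK 2.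
  case: ifP => _.
    by apply: (ac_div acK) => //; exact: (acD acK).
  apply: (ac_div acK); first exact: (acB acK).
  by apply: (acM acK) => //; exact: ac_imaginary.
rewrite (generic_rank p_generic) rank_cat mulnC => h; apply: (leq_trans h).
by rewrite addnC leq_add2l; exact: (rank_over_size L t).
Qed.

End GenericRealisation.

Lemma generic_realisation_count (E : rel 'I_n) (p : 'M[C]_(n, 2)) : inQ E ->
  (forall P : {mpoly rat[n * 2]}, P != 0 ->
    (map_mpoly (ratr : rat -> C) P).@[fun k => mxvec p 0 k] != 0) ->
  exists qs : 'I_(2 ^ (n - 3)) -> 'M[C]_(n, 2),
    [/\ (forall k, equivalent E p (qs k)),
        (forall k l, congruent (qs k) (qs l) -> k = l) &
        (forall q : 'M[C]_(n, 2), equivalent E p q ->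
           exists k, congruent q (qs k))].
Proof.
move=> /(inQ_counted C)[n2 [s [Es _ alg cnt]]] p_generic.
rewrite card_ord in n2; rewrite /realisation_count card_ord in cnt.
have [qs [r_qs inj_qs all_qs]] :=
  cnt _ (distC (isotropic p)) (generic_lengths_rank p_generic n2 alg).
exists (fun k => cartesian (qs k)); split.
- by move=> k x y xy; rewrite sqd_isotropic sqd_cartesian (r_qs k).
- move=> k l kl; apply: inj_qs => x y.
  by have := kl x y; rewrite !sqd_cartesian.
- move=> q qE; have [k qk] : exists k, dist (isotropic q) =2 dist (qs k).
    by apply: all_qs => x y xy; rewrite -!sqd_isotropic (qE x y xy).
  by exists k => x y; rewrite sqd_isotropic sqd_cartesian.
Qed.

End Realisations.

Unset Implicit Arguments.

Theorem theorem9p1 (R : realType) (n : nat) (E : rel 'I_n) :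
  inQ E ->
  forall p : 'M[R[i]]_(n, 2), generic p ->
  exists qs : 'I_(2 ^ (n - 3)) -> 'M[R[i]]_(n, 2),
    [/\ (forall k, equivalent E p (qs k)),
        (forall k l, congruent (qs k) (qs l) -> k = l) &
        (forall q : 'M[R[i]]_(n, 2), equivalent E p q ->
           exists k, congruent q (qs k))].
Proof. by move=> EQ p; exact: generic_realisation_count. Qed.
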